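(* Let $d,k\ge1$, let $\mathcal{I}\subset\mathbb{R}\setminus\{0\}$ be a finite set, and let $\lambda_j^{(i)}$, $i\in\mathcal{I}$, $1\le j\le k$, be positive constants. Let $\{M_i(A),\ A\in\mathcal{A}_d\}\sim GPRF\{\lambda_j^{(i)}\}_{1\le j\le k}$, $i\in\mathcal{I}$, be independent generalized Poisson random fields and let $S(A)=\sum_{i\in\mathcal{I}}iM_i(A)$, $A\in\mathcal{A}_d$. Let $(X_1,Y_1),(X_2,Y_2),\dots$ be iid random vectors with values in $\mathcal{I}\times\{1,\dots,k\}$ such that $$\Pr\{X_1=i,\,Y_1=j\}=\frac{\lambda_j^{(i)}}{\sum_{i\in\mathcal{I}}\sum_{j=1}^{k}\lambda_j^{(i)}},\quad(i,j)\in\mathcal{I}\times\{1,\dots,k\},$$ and let $\{N(A),\ A\in\mathcal{A}_d\}$ be a Poisson random field with rate parameter $\sum_{i\in\mathcal{I}}\sum_{j=1}^{k}\lambda_j^{(i)}$, independent of $\{(X_r,Y_r)\}_{r\ge1}$. Then for each $A\in\mathcal{A}_d$, $$S(A)\overset{d}{=}\sum_{r=1}^{N(A)}X_rY_r,$$ where $\overset{d}{=}$ denotes equality in distribution.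
   Context: $\mathbb{R}_+=[0,\infty)$, and $\mathcal{A}_d$ is the collection of bounded axis-parallel rectangles (products of $d$ bounded intervals) in $\mathbb{R}^d_+$; $|A|$ is the Lebesgue measure of $A$. Poisson random field (PRF) with rate $\lambda>0$: a non-negative integer valued random measure $\{N(A),\ A\in\mathcal{A}_d\}$ on $\mathbb{R}^d_+$ such that $N(A)$ is Poisson distributed with mean $\lambda|A|$ for each $A\in\mathcal{A}_d$, and $N(A_1),\dots,N(A_m)$ are independent for any finite collection of disjoint $A_1,\dots,A_m\in\mathcal{A}_d$. Generalized Poisson random field $GPRF\{\lambda_j\}_{1\le j\le k}$ (with $\lambda_1,\dots,\lambda_k>0$): a non-negative integer valued random measure $\{M(A),\ A\in\mathcal{A}_d\}$ such that for each $A\in\mathcal{A}_d$ $$\Pr\{M(A)=n\}=\sum_{(n_1,\dots,n_k)\in\Theta(k,n)}\ \prod_{j=1}^{k}\frac{(\lambda_j|A|)^{n_j}}{n_j!}e^{-\lambda_j|A|},\quad n\ge0,$$ where $\Theta(k,n)=\{(n_1,\dots,n_k)\in\mathbb{N}_0^k:\sum_{j=1}^k jn_j=n\}$, and $M(A_1),\dots,M(A_m)$ are independent for any disjoint $A_1,\dots,A_m\in\mathcal{A}_d$. *)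

(* Defs.v *)
From HB Require Import structures.
From mathcomp Require Import all_boot all_order all_algebra finmap.
From mathcomp Require Import all_classical all_reals all_analysis measurable_realfun.

Set Implicit Arguments.
Unset Strict Implicit.
Unset Printing Implicit Defensive.

Import Order.TTheory GRing.Theory Num.Theory.
Import numFieldNormedType.Exports.

Local Open Scope classical_set_scope.
Local Open Scope ring_scope.

Section Rectangles.
Context {R : realType}.

(* Points of R^d are d-tuples, with the product sigma-algebra of the library. *)

Definition orthant {d : nat} : set (d.-tuple R) :=
  [set x | forall i, 0 <= tnth x i].

(* Empty and degenerate sides are allowed. *)
Definition rectangle {d : nat} : set (set (d.-tuple R)) :=
  [set A | exists J : 'I_d -> interval R,
    [/\ forall i, bounded_set [set` J i],
        forall i, [set` J i] `<=` `[0, +oo[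
      & A = [set x | forall i, tnth x i \in J i]]].

(* The iterated product of the one-dimensional Lebesgue measure, following the
   formula of the library's binary product measure [\x]. *)
Fixpoint lebesgue_tuple {d : nat} : set (d.-tuple R) -> \bar R :=
  match d with
  | 0 => fun A => \d_([tuple] : 0.-tuple R) A
  | d'.+1 => fun A =>
      (\int[lebesgue_measure]_x
        lebesgue_tuple [set t : d'.-tuple R | A [tuple of x :: t]])%E
  end.

Lemma lebesgue_tuple0 (d : nat) : lebesgue_tuple (set0 : set (d.-tuple R)) = 0%E.
Proof.
elim: d => [|d IH] /=; first by rewrite diracE in_set0.
rewrite (_ : (fun _ => _) = cst 0%E) ?integral0//; apply/funext => x /=.
by rewrite -[RHS]IH.
Qed.

Lemma lebesgue_tuple_box (d : nat) (J : 'I_d -> interval R) :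
  lebesgue_tuple [set x | forall i, tnth x i \in J i] =
  (\prod_(i < d) lebesgue_measure [set` J i])%E.
Proof.
elim: d J => [|d IH] J /=.
  by rewrite big_ord0 diracE mem_set// => -[].
have secE (x : R) :
    lebesgue_tuple
      [set t : d.-tuple R | forall i, tnth [tuple of x :: t] i \in J i] =
    ((\1_[set` J ord0] x)%:E *
      \prod_(i < d) lebesgue_measure [set` J (lift ord0 i)])%E.
  rewrite -(IH (fun i => J (lift ord0 i))) indicE.
  have [Jx|Jx] := boolP (x \in J ord0).
    rewrite mem_set//= mul1e; congr lebesgue_tuple.
    apply/seteqP; split => t /= tJ i; first by have := tJ (lift ord0 i); rewrite tnthS.
    by have [j ->|->] := unliftP ord0 i; rewrite ?tnthS ?tnth0.
  rewrite memNset/= ?mul0e; last exact/negP.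
  rewrite (_ : [set t | _] = set0) ?lebesgue_tuple0//.
  apply/seteqP; split => t //= /(_ ord0); rewrite tnth0 => Jx'.
  by rewrite Jx' in Jx.
transitivity (\int[lebesgue_measure]_x ((\1_[set` J ord0] x)%:E *
    \prod_(i < d) lebesgue_measure [set` J (lift ord0 i)]))%E.
  by apply: eq_integral => x _; exact: secE.
rewrite ge0_integralZr//.
- by rewrite integral_indic// setIT big_ord_recl.
- by apply/measurable_EFinP; exact: measurable_indic.
- by apply: prode_ge0.
Qed.

(* A bounded rectangle has finite measure, so [fine] loses nothing there. *)
Definition volume {d : nat} (A : set (d.-tuple R)) : R :=
  fine (lebesgue_tuple A).

End Rectangles.

Section Independence.
Context {R : realType} {dT : measure_display} {T : measurableType dT}.
Variable P : probability T R.

Definition independent2 (F G : set (set T)) : Prop :=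
  forall A B, F A -> G B -> P (A `&` B) = (P A * P B)%E.

Definition mutually_independent (I : choiceType) (F : I -> set (set T)) : Prop :=
  forall (J : {fset I}) (E : I -> set T), (forall i, i \in J -> F i (E i)) ->
    P (\bigcap_(i in [set` J]) E i) = (\prod_(i <- J) P (E i))%E.

Context {dU : measure_display} {U : measurableType dU}.

Definition sigma_of (X : T -> U) : set (set T) :=
  preimage_set_system setT X measurable.

Definition sigma_of_family (I : Type) (D : set I) (X : I -> T -> U) :
    set (set T) :=
  <<s \bigcup_(i in D) sigma_of (X i) >>.

End Independence.

Definition eq_in_law {R : realType} {dT dT' dU : measure_display}
    {T : measurableType dT} {T' : measurableType dT'} {U : measurableType dU}
    (P : probability T R) (X : T -> U) (P' : probability T' R) (X' : T' -> U) :
    Prop :=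
  [/\ measurable_fun setT X, measurable_fun setT X' &
      forall B, measurable B -> P (X @^-1` B) = P' (X' @^-1` B)].

Section RandomFields.
Context {R : realType} {dT : measure_display} {T : measurableType dT} {d : nat}.

(* A random measure on the orthant is a kernel into R^d carried by the
   orthant.  Integrality is required on the bounded rectangles only: other Borel
   sets may have infinite mass. *)
Definition integer_valued_random_measure
    (N : R.-ker T ~> d.-tuple R) : Prop :=
  (forall w, N w (~` orthant) = 0%E) /\
  (forall w A, rectangle A -> exists n : nat, N w A = n%:R%:E).

Definition independent_increments (P : probability T R)
    (N : R.-ker T ~> d.-tuple R) : Prop :=
  forall (m : nat) (A : 'I_m -> set (d.-tuple R)),
    (forall i, rectangle (A i)) -> trivIset setT A ->
    mutually_independent P (fun i => sigma_of (fun w => N w (A i))).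

(* The second argument of [poisson_prob] is a dummy; [poisson_prob 0] is the
   Dirac mass at 0, which is the case of a rectangle of volume 0. *)
Definition poisson_random_field (P : probability T R) (rate : R)
    (N : R.-ker T ~> d.-tuple R) : Prop :=
  [/\ 0 < rate, integer_valued_random_measure N,
      forall A, rectangle A -> forall n : nat,
        P [set w | N w A = n%:R%:E] = poisson_prob (rate * volume A) 0 [set n]
    & independent_increments P N].

(* Indices are shifted: the j-th component of x stands for n_{j+1}. *)
Definition Theta (k n : nat) : set {ffun 'I_k -> nat} :=
  [set x | (\sum_(j < k) j.+1 * x j)%N = n].
Arguments Theta : clear implicits.

(* The rates are lambda 1, ..., lambda k; other values of lambda are unused. *)
Definition generalized_poisson_random_field (P : probability T R) (k : nat)
    (lambda : nat -> R) (M : R.-ker T ~> d.-tuple R) : Prop :=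
  [/\ forall j : 'I_k, 0 < lambda j.+1, integer_valued_random_measure M,
      forall A, rectangle A -> forall n : nat,
        P [set w | M w A = n%:R%:E] =
        \esum_(x in Theta k n)
          (\prod_(j < k) ((lambda j.+1 * volume A) ^+ x j / (x j)`!%:R
                          * expR (- (lambda j.+1 * volume A))))%:E
    & independent_increments P M].

(* The sigma-algebra generated by the variables N(A), A a bounded rectangle. *)
Definition sigma_of_field (N : R.-ker T ~> d.-tuple R) : set (set T) :=
  sigma_of_family rectangle (fun A w => N w A).

(* The mass of A as a natural number; exact when N w A is an integer, as it is
   for the rectangles in [integer_valued_random_measure]. *)
Definition point_count (N : R.-ker T ~> d.-tuple R) (A : set (d.-tuple R)) (w : T) :
    nat :=
  Num.truncn (fine (N w A)).

End RandomFields.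

(* Main.v *)
(** Let K = I x {1..k}.  The sum over Theta(k,n) in the law of a GPRF is the law
    of z_1 + 2 z_2 + ... + k z_k with independent Poisson z_j, so S(A) has the
    law of the sum of i j z(i,j) over K, with z(i,j) independent Poisson of mean
    lambda_j^(i) |A|.  On the right, the random word (X_1,Y_1), ...,
    (X_N(A),Y_N(A)) equals s with probability
    pois(L|A|)(size s) * prod_{c in s} lambda_c / L, which depends only on the
    mark counts z of s, and (sum_c z_c)! / prod_c z_c! words have mark counts z;
    so the mark counts follow the same product of Poisson laws. *)
Require Import Defs.
From mathcomp Require Import all_boot all_order all_algebra finmap.
From mathcomp Require Import all_classical all_reals all_analysis measurable_realfun.
From mathcomp Require Import ring.

Set Implicit Arguments.
Unset Strict Implicit.
Unset Printing Implicit Defensive.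

Import Order.TTheory GRing.Theory Num.Theory.
Import numFieldNormedType.Exports.

Local Open Scope classical_set_scope.
Local Open Scope ring_scope.

(** * Sums over fibers and laws on countable spaces *)

Section CountableFibers.

(** Projection to the second component is a bijection from the pairs [(v, x)] with [D v] and
    [h x = v] onto the preimage of [D]. *)
Lemma esum_fibers (R : realType) (U V : choiceType) (h : U -> V) (D : set V)
    (a : U -> \bar R) : (forall x, 0 <= a x)%E ->
  \esum_(x in h @^-1` D) a x = \esum_(v in D) \esum_(x in h @^-1` [set v]) a x.
Proof.
move=> a0; rewrite esum_esum//.
apply: (reindex_esum _ _ (fun k : V * U => k.2)); split.
- by move=> [v x] [/= Dv hx]; rewrite /= hx.
- by move=> [v x] [v' x'] /set_mem[/= _ <-] /set_mem[/= _ <-] /= ->.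
- by move=> x /= Dx; exists (h x, x).
Qed.

(** Trades an extended sum for a finite real [\sum], on which the distributivity and cardinality
    lemmas of big operators act. The finite type [J] may overshoot [D]; the filter removes the
    excess. *)
Lemma esum_fin_preimage (R : realType) (J : finType) (U : choiceType)
    (e : J -> U) (D : set U) (a : U -> R) : injective e ->
    (forall x, D x -> exists j, e j = x) -> (forall x, 0 <= a x) ->
  \esum_(x in D) (a x)%:E = (\sum_(j : J | `[< D (e j) >]) a (e j))%:E.
Proof.
move=> inj_e De a0.
have eD : set_bij [set j | D (e j)] D e.
  split => [j //|i j _ _ /inj_e //|x Dx].
  by have [j ej] := De _ Dx; exists j => //=; rewrite ej.
rewrite (reindex_esum _ _ _ _ eD) esum_mkcond esum_fset; first last.
- by move=> j _; case: ifP => // _; rewrite lee_fin.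
- exact: finite_finset.
rewrite (fsbigE (index_enum J))//=; first last.
- by move=> j _; rewrite mem_index_enum.
- exact: index_enum_uniq.
rewrite -sumEFin [RHS]big_mkcond; apply: eq_big => j; first by rewrite in_setT.
by move=> _; rewrite /in_mem /=.
Qed.

Context d (T : measurableType d) (R : realType) (P : probability T R).

(** Countable additivity along the values of [f]. Only the fibers have to be measurable, so no
    sigma-algebra on [C] is involved, and a law on counts or on words is settled by its point
    masses. *)
Lemma countable_fibers (C : countType) (f : T -> C) (D : set C) :
    (forall c, measurable (f @^-1` [set c])) ->
  measurable (f @^-1` D) /\
  P (f @^-1` D) = \esum_(c in D) P (f @^-1` [set c]).
Proof.
move=> mf.
(* [choice.pickle] turns the fibers over [D] into a disjoint sequence; [F n] is empty when [n] is
   not the code of an element of [D]. *)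
pose F n := [set w | D (f w) /\ choice.pickle (f w) = n].
have FE c : D c -> F (choice.pickle c) = f @^-1` [set c].
  move=> Dc; apply/seteqP; split => [w [_ /(pcan_inj choice.pickleK)]//|w fwc].
  by split; rewrite fwc.
have F0 n : ~ (choice.pickle @` D) n -> F n = set0.
  by move=> nD; apply/seteqP; split => // w [Dw wn]; apply: nD; exists (f w).
have mF n : measurable (F n).
  have [[c Dc <-]|/F0 -> //] := pselect ((choice.pickle @` D) n).
  by rewrite FE.
have DE : f @^-1` D = \bigcup_n F n.
  by apply/seteqP; split => [w Dw|w [n _ [Dw _]] //]; exists (choice.pickle (f w)).
have mD : measurable (f @^-1` D) by rewrite DE; exact: bigcup_measurable.
split => //; rewrite DE measure_semi_bigcup -?DE//; last first.
  by move=> m n _ _ [w [[_ <-] [_ <-]]].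
rewrite nneseries_esumT//.
transitivity (\esum_(n in choice.pickle @` D) P (F n)).
  rewrite [RHS]esum_mkcond; apply: eq_esum => n _.
  by case: ifPn => // /negP nD; rewrite F0 ?measure0// => /mem_set.
rewrite esum_image; last by move=> x y _ _; exact: (pcan_inj choice.pickleK).
by apply: eq_esum => c Dc; rewrite FE.
Qed.

End CountableFibers.

(** * Multinomial coefficients as numbers of words *)

Section Multinomial.
Variable K : finType.

(** Induction on the first letter. The words that begin with [c] contribute [z c * n!], and summing
    over [c] gives [(n + 1) * n!]. The product form avoids a division in [nat]. *)
Lemma card_tuple_count n (z : K -> nat) : (\sum_c z c)%N = n ->
  (#|[pred t : n.-tuple K | [forall c, count_mem c t == z c]]|
     * \prod_c (z c)`!)%N = n`!.
Proof.
elim: n z => [|n IH] z zn.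
  have z0 c : z c = 0%N by move/eqP: zn; rewrite sum_nat_eq0 => /forallP/(_ c)/eqP.
  rewrite big1 ?muln1; last by move=> c _; rewrite z0.
  rewrite (@fintype.eq_card1 _ [tuple]) // => t.
  by rewrite !inE tuple0 eqxx; apply/forallP => c; rewrite z0.
have step c : (#|[pred t : n.-tuple K |
      [forall c', count_mem c' (c :: t) == z c']]| * \prod_c (z c)`!)%N
    = (z c * n`!)%N.
  have [zc0|zc_gt0] := posnP (z c).
    rewrite zc0 mul0n eq_card0// => t; rewrite !inE; apply/negP => /forallP/(_ c).
    by rewrite /= eqxx zc0.
  (* The counts left for the tail once a leading [c] is removed; the truncated subtraction is exact
     because [z c > 0]. *)
  pose z' c' := (z c' - (c == c'))%N.
  have z'E c' : z c' = ((c == c') + z' c')%N.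
    by rewrite /z' subnKC//; case: eqP => // <-.
  have z'n : (\sum_c' z' c')%N = n.
    apply/eqP; rewrite -(eqn_add2l 1) [eqbRHS]add1n -zn (eq_bigr _ (fun c' _ => z'E c')).
    rewrite big_split/= eqn_add2r (bigD1 c)//= eqxx big1// => c'.
    by rewrite eq_sym => /negbTE ->.
  rewrite -(IH _ z'n) mulnCA; congr (_ * _)%N.
    apply: eq_card => t; rewrite !inE; apply: eq_forallb => c' /=.
    by rewrite z'E eqn_add2l.
  rewrite [LHS](bigD1 c)//= [in RHS](bigD1 c)//= mulnA; congr (_ * _)%N.
    by rewrite [in LHS]z'E eqxx /= add1n factS -add1n [in RHS]z'E eqxx.
  by apply: eq_bigr => c'; rewrite eq_sym z'E => /negbTE ->.
(* A word of length [n.+1] is split into its head and its tail, so that [step] applies to each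
   head. *)
rewrite -sum1_card (reindex (fun p : K * n.-tuple K => [tuple of p.1 :: p.2]))/=.
  rewrite -(pair_big_dep xpredT
    (fun c (t : n.-tuple K) => [forall c', count_mem c' (c :: t) == z c'])
    (fun _ _ => 1%N))/=.
  rewrite big_distrl/= (eq_bigr (fun c => (z c * n`!)%N)) => [|c _].
    by rewrite -big_distrl zn factS.
  by rewrite -step -sum1_card.
exists (fun t => (thead t, [tuple of behead t])) => [[c t] _|t _].
  by congr (_, _); apply/val_inj.
by rewrite [RHS]tuple_eta; apply/val_inj.
Qed.

End Multinomial.

(** Distributivity of a finite product over sums: a term of the expansion is a choice function [y].
    Finiteness of the [D i] reduces it to the finite big-operator version. *)
Lemma prod_esum_finite (R : realType) (I : finType) (U : choiceType)
    (D : I -> set U) (a : I -> U -> R) :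
    (forall i, finite_set (D i)) -> (forall i x, 0 <= a i x) ->
  (\prod_(i : I) \esum_(x in D i) (a i x)%:E)%E =
  \esum_(y in [set y : {ffun I -> U} | forall i, D i (y i)])
    (\prod_(i : I) a i (y i))%:E.
Proof.
move=> finD a0.
(* One finite index set that contains every [D i], since the finite distributivity law needs a
   common index type. *)
pose J : {fset U} := fset_set (\bigcup_(i in [set: I]) D i).
have DJ i x : D i x -> x \in J.
  move=> Dx; rewrite in_fset_set ?inE; last exact: bigcup_finite.
  by exists i.
have eD i : \esum_(x in D i) (a i x)%:E =
    (\sum_(j : J | `[< D i (val j) >]) a i (val j))%:E.
  rewrite (@esum_fin_preimage _ J _ val)//.
  by move=> x /DJ Jx; exists [` Jx]%fset.
under eq_bigr do rewrite eD.
rewrite prodEFin bigA_distr_big_dep.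
pose e (f : {ffun I -> J}) : {ffun I -> U} := [ffun i => val (f i)].
rewrite (@esum_fin_preimage _ _ _ e); first last.
- by move=> y; apply: prodr_ge0 => i _.
- move=> y Dy; exists [ffun i => [` DJ i _ (Dy i)]%fset].
  by apply/ffunP => i; rewrite !ffunE.
- move=> f g /ffunP fg; apply/ffunP => i; apply: val_inj.
  by have := fg i; rewrite !ffunE.
congr EFin; apply: eq_big => f.
  apply/familyP/asboolP => Df i; first by rewrite ffunE; exact/asboolP/Df.
  by have := Df i; rewrite ffunE => /asboolP.
by move=> _; apply: eq_bigr => i _; rewrite ffunE.
Qed.

(** * Poisson weights and random words with given letter counts *)

Section PoissonWords.
Context {R : realType}.

Definition pois (a : R) (n : nat) : R := a ^+ n / n`!%:R * expR (- a).

Lemma pois_ge0 a n : 0 <= a -> 0 <= pois a n.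
Proof. by move=> a0; rewrite !mulr_ge0 ?exprn_ge0 ?expR_ge0 ?invr_ge0. Qed.

(** At [a = 0] the left side is a Dirac mass at 0, and the formula for [pois] agrees with it because
    [0 ^+ 0 = 1]. *)
Lemma poisson_prob_set1 (a : R) m n : 0 <= a ->
  poisson_prob a m [set n] = (pois a n)%:E.
Proof.
rewrite /poisson_prob le_eqVlt => /predU1P[<-|a0].
  rewrite ltxx diracE /pois oppr0 expR0 mulr1 expr0n.
  case: n => [|n]; last by rewrite memNset//= mul0r.
  by rewrite mem_set//= fact0 divr1.
by rewrite a0 esum_set1 ?lee_fin ?poisson_pmf_ge0// /poisson_pmf a0.
Qed.

(** All words with counts [z] have the same length and the same weight, so the sum is a multinomial
    coefficient times that weight. Its numerator cancels the factorial in the Poisson weight of the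
    length, and the powers of the total rate cancel too. *)
Lemma esum_word_counts (K : finType) (lambda : K -> R) (t : R) (z : K -> nat) :
    (forall c, 0 <= lambda c) -> 0 < \sum_c lambda c -> 0 <= t ->
  \esum_(s in [set s : seq K | forall c, count_mem c s = z c])
    (pois (\sum_c lambda c * t) (size s)
      * \prod_(c <- s) (lambda c / \sum_c' lambda c'))%:E =
  (\prod_c pois (lambda c * t) (z c))%:E.
Proof.
set L := \sum_c lambda c => lam0 L0 t0; rewrite -mulr_suml -/L.
pose n := (\sum_c z c)%N.
have size_s s : (forall c, count_mem c s = z c) -> size s = n.
  move=> sz; rewrite -count_predT -sum1_count /n (partition_big id xpredT)//=.
  by apply: eq_bigr => c _; rewrite sum1_count sz.
rewrite (@esum_fin_preimage _ _ _ (@tval n K)); first last.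
- move=> s; apply: mulr_ge0; first by rewrite pois_ge0// mulr_ge0// ltW.
  by apply: prodr_ge0 => c _; rewrite divr_ge0// ltW.
- by move=> s /= /size_s/eqP sn; exists (Tuple sn).
- exact: val_inj.
pose w := pois (L * t) n * \prod_c (lambda c / L) ^+ z c.
rewrite [in LHS](eq_bigr (fun _ => w)); last first.
  move=> s /asboolP sz; rewrite size_tuple; congr (_ * _).
  rewrite (partition_big id xpredT)//=; apply: eq_bigr => c _.
  rewrite (eq_bigr (fun _ => lambda c / L)) => [|i /eqP -> //].
  by rewrite -sz big_const_seq iter_mulr_1.
rewrite sumr_const /w.
(* Each factor is split as [lambda c * t = (lambda c / L) * (L * t)], so that both sides carry the
   same powers. *)
have zP c : pois (lambda c * t) (z c) =
    (lambda c / L) ^+ z c * (L * t) ^+ z c / (z c)`!%:R * expR (- (lambda c * t)).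
  by rewrite /pois -exprMn mulrA divfK// gt_eqF.
rewrite (eq_bigr _ (fun c _ => zP c)) !big_split/= prodfV prodrXr -expR_sum.
rewrite sumrN -mulr_suml -/L -/n /pois.
congr EFin; rewrite -[LHS]mulr_natr.
set q := #|_|.
have qE : (q * \prod_c (z c)`!)%N = n`!.
  rewrite -(card_tuple_count (erefl n)); congr (_ * _)%N; apply: eq_card => s.
  by rewrite !inE; apply/asboolP/forallP => sz c; apply/eqP; rewrite sz.
have : q%:R * \prod_c (z c)`!%:R = n`!%:R :> R by rewrite -qE natrM natr_prod.
have : \prod_c (z c)`!%:R != 0 :> R.
  by apply/prodf_neq0 => c _; rewrite pnatr_eq0 -lt0n fact_gt0.
have : n`!%:R != 0 :> R by rewrite pnatr_eq0 -lt0n fact_gt0.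
(* Writing [n!] as [q * zf] leaves a rational identity; [n! != 0] then yields [q != 0], which
   [field] needs. *)
move: (\prod_c (z c)`!%:R) => zf n0 zf0 qzf; rewrite -qzf in n0 *.
move: n0; rewrite mulf_eq0 negb_or => /andP[q0 _].
by field; apply/andP.
Qed.

End PoissonWords.

(** * Joint laws of the counts of the fields and of the random word *)

Section RandomFieldLaws.
Context {R : realType} {d : nat}.
Context {dT : measure_display} {T : measurableType dT} {P : probability T R}.

Lemma rectangle_measurable (A : set (d.-tuple R)) : rectangle A -> measurable A.
Proof.
move=> [J [_ _ ->]].
rewrite (_ : [set x | _] =
    \bigcap_(i in [set: 'I_d]) ((@tnth _ _)^~ i @^-1` [set` J i])).
  apply: fin_bigcap_measurable => [|i _]; first exact: finite_finset.
  by rewrite -[X in measurable X]setTI; apply: measurable_tnth.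
by apply/seteqP; split => [x xJ i _|x xJ i]; exact: xJ.
Qed.

Lemma volume_ge0 (A : set (d.-tuple R)) : rectangle A -> 0 <= volume A.
Proof.
by move=> [J [_ _ ->]]; rewrite fine_ge0// lebesgue_tuple_box prode_ge0.
Qed.

Lemma point_count_fiber (N : R.-ker T ~> d.-tuple R) A n :
    integer_valued_random_measure N -> rectangle A ->
  point_count N A @^-1` [set n] = [set w | N w A = n%:R%:E].
Proof.
move=> [_ Nint] rA; apply/seteqP; split => w; rewrite /= /point_count.
  by have [m ->] := Nint w _ rA; rewrite /= natrK => ->.
by move=> ->; rewrite /= natrK.
Qed.

Lemma sigma_of_field_count (N : R.-ker T ~> d.-tuple R) A n : rectangle A ->
  sigma_of_field N [set w | N w A = n%:R%:E].
Proof.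
move=> rA; apply: sub_gen_smallest; exists A => //.
by exists [set n%:R%:E]; [exact: emeasurable_set1|rewrite setTI].
Qed.

Lemma measurable_count (N : R.-ker T ~> d.-tuple R) A n : rectangle A ->
  measurable [set w | N w A = n%:R%:E].
Proof.
move=> rA; rewrite -[X in measurable X]setTI.
have mA := rectangle_measurable rA.
exact: (measurable_kernel N A mA _ _ (emeasurable_set1 n%:R%:E)).
Qed.

(** Lets independence be applied along the enumerations [enum I] and [iota]. *)
Lemma mutually_independent_seq (I : choiceType) (F : I -> set (set T))
    (E : I -> set T) (s : seq I) :
    mutually_independent P F -> uniq s -> (forall i, i \in s -> F i (E i)) ->
  P (\bigcap_(i in [set` s]) E i) = (\prod_(i <- s) P (E i))%E.
Proof.
move=> indF us FE; pose J := [fset i in s]%fset.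
have Js : J =i s by move=> i; rewrite !inE.
have -> : [set` s] = [set` J] by apply/seteqP; split => i /=; rewrite Js.
rewrite indF => [|i]; last by rewrite Js => /FE.
by apply/perm_big/uniq_perm.
Qed.

(** Every weight [j.+1] is at least 1, so each entry of a solution is at most [n]. *)
Lemma Theta_finite k n : finite_set (@Theta k n).
Proof.
pose e (f : {ffun 'I_k -> 'I_n.+1}) : {ffun 'I_k -> nat} := [ffun j => val (f j)].
apply: (@sub_finite_set _ _ (e @` setT)); last exact/finite_image/finite_finset.
move=> x xn.
have xle j : (x j < n.+1)%N.
  by rewrite ltnS -xn (bigD1 j)//= (leq_trans _ (leq_addr _ _))// leq_pmull.
exists [ffun j => Ordinal (xle j)] => //.
by apply/ffunP => j; rewrite !ffunE.
Qed.

Section GPRF.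
Variables (I : finType) (k : nat) (lambda : I -> nat -> R).
Variable M : I -> R.-ker T ~> d.-tuple R.
Hypothesis hM : forall i, generalized_poisson_random_field P k (lambda i) (M i).
Hypothesis indM : mutually_independent P (fun i => sigma_of_field (M i)).
Variables (A : set (d.-tuple R)) (rA : rectangle A).

(** By independence a point mass of the counts is a product over [i] of sums over [Theta k (n i)].
    Expanding it makes the law the image of a product of Poisson laws on arrays [z]. *)
Lemma gprf_counts_law (D : set {ffun I -> nat}) :
  let counts w := [ffun i => point_count (M i) A w] in
  measurable (counts @^-1` D) /\
  P (counts @^-1` D) =
  \esum_(z in [set z : {ffun I -> {ffun 'I_k -> nat}} |
               D [ffun i => \sum_(j < k) j.+1 * z i j]%N])
    (\prod_i \prod_(j < k) pois (lambda i j.+1 * volume A) (z i j))%:E.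
Proof.
move=> counts.
have fiberE n : counts @^-1` [set n] =
    \bigcap_(i in [set` enum I]) [set w | M i w A = (n i)%:R%:E].
  apply/seteqP; split => [w /= <- i _|w wn].
    have [_ Mi _ _] := hM i; rewrite ffunE.
    by rewrite -[X in X w](point_count_fiber _ Mi rA).
  apply/ffunP => i; rewrite ffunE; have [_ Mi _ _] := hM i.
  suff : (point_count (M i) A @^-1` [set n i]) w by [].
  by rewrite (point_count_fiber _ Mi rA); apply: wn; rewrite /= mem_enum.
have pois_ge0 (i : I) (x : {ffun 'I_k -> nat}) :
    0 <= \prod_(j < k) pois (lambda i j.+1 * volume A) (x j).
  apply: prodr_ge0 => j _; have [lam0 _ _ _] := hM i.
  by rewrite pois_ge0// mulr_ge0 ?volume_ge0// ltW.
have [|mD ->] := countable_fibers P (f := counts) D.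
  move=> n; rewrite fiberE; apply: fin_bigcap_measurable => [|i _].
    exact: finite_seq.
  exact: measurable_count.
split => //.
pose h (z : {ffun I -> {ffun 'I_k -> nat}}) : {ffun I -> nat} :=
  [ffun i => \sum_(j < k) j.+1 * z i j]%N.
rewrite (@esum_fibers _ _ _ h D) => [|z]; last by rewrite lee_fin prodr_ge0.
apply: eq_esum => n _; rewrite fiberE (mutually_independent_seq indM).
- rewrite enumT (eq_bigr (fun i => \esum_(x in @Theta k (n i))
      (\prod_(j < k) pois (lambda i j.+1 * volume A) (x j))%:E)); last first.
    by move=> i _; have [_ _ /(_ A rA) -> _] := hM i.
  rewrite prod_esum_finite//; last by move=> i; exact: Theta_finite.
  (* A choice of a member of [Theta k (n i)] for each [i] is the same as an array [z] with
     [h z = n]. *)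
  congr esum; apply/seteqP; split => [z zn|z <- i].
    by apply/ffunP => i; rewrite ffunE; exact: zn.
  by rewrite /Theta/= ffunE.
- exact: enum_uniq.
- by move=> i _; exact: sigma_of_field_count.
Qed.

End GPRF.

(** The random word is [s] exactly when [N] has [size s] points in [A] and the first [size s] marks
    spell [s]. The second event lies in [F], so independence factors each point mass. *)
Lemma compound_words_law (K : finType) (mark : nat -> T -> K) (p : K -> R)
    (rate : R) (N : R.-ker T ~> d.-tuple R) (F : set (set T))
    (A : set (d.-tuple R)) (D : set (seq K)) :
  let prefix_eq s := [set w | [seq mark r w | r <- iota 0 (size s)] = s] in
  let word w := [seq mark r w | r <- iota 0 (point_count N A w)] in
    (forall s, measurable (prefix_eq s)) -> (forall s, F (prefix_eq s)) ->
    (forall s, P (prefix_eq s) = (\prod_(c <- s) p c)%:E) ->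
    independent2 P (sigma_of_field N) F ->
    poisson_random_field P rate N -> rectangle A ->
  measurable (word @^-1` D) /\
  P (word @^-1` D) =
    \esum_(s in D) (pois (rate * volume A) (size s) * \prod_(c <- s) p c)%:E.
Proof.
move=> prefix_eq word mE FE PE indN [rate0 Nint Nlaw _] rA.
have fiberE s : word @^-1` [set s] =
    [set w | N w A = (size s)%:R%:E] `&` prefix_eq s.
  rewrite -(point_count_fiber _ Nint rA); apply/seteqP.
  split => [w /= ws|w [/= ws sE]]; last by rewrite /word ws.
  by rewrite /prefix_eq/= -ws /word size_map size_iota.
have [|mD ->] := countable_fibers P (f := word) D.
  by move=> s; rewrite fiberE; apply: measurableI => //; exact: measurable_count.
split => //; apply: eq_esum => s _.
rewrite fiberE indN//; last exact: sigma_of_field_count.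
by rewrite Nlaw// poisson_prob_set1 ?PE// mulr_ge0 ?volume_ge0// ltW.
Qed.

End RandomFieldLaws.

Lemma sum_count_mem (V : nmodType) (K : finType) (s : seq K) (F : K -> V) :
  \sum_(c <- s) F c = \sum_c F c *+ count_mem c s.
Proof.
rewrite (partition_big id xpredT)//=; apply: eq_bigr => c _.
rewrite (eq_bigr (fun _ => F c)) => [|i /eqP -> //].
by rewrite big_const_seq iter_addr_0.
Qed.

(** * Comparison of the two laws *)

Theorem proposition5p1 (R : realType) (d k : nat) (hd : (1 <= d)%N)
  (hk : (1 <= k)%N)
  (I : {fset R}) (hI : 0 \notin I)
  (lambda : I -> nat -> R)
  (hlambda : forall (i : I) (j : nat), (1 <= j <= k)%N -> 0 < lambda i j)
  (* the fields M_i *)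
  (dT : measure_display) (T : measurableType dT) (P : probability T R)
  (M : I -> R.-ker T ~> d.-tuple R)
  (hM : forall i : I, generalized_poisson_random_field P k (lambda i) (M i))
  (hMindep : mutually_independent P (fun i : I => sigma_of_field (M i)))
  (* the vectors (X_r, Y_r) and the field N *)
  (dT' : measure_display) (T' : measurableType dT') (P' : probability T' R)
  (X : nat -> {RV P' >-> R}) (Y : nat -> {RV P' >-> nat})
  (hXY : forall r w, X r w \in I /\ (1 <= Y r w <= k)%N)
  (hXYindep : mutually_independent P'
    (fun r : nat => sigma_of (fun w => (X r w, Y r w))))
  (hXYident : forall r : nat,
    eq_in_law P' (fun w => (X r w, Y r w)) P' (fun w => (X 0%N w, Y 0%N w)))
  (hXYlaw : forall (i : I) (j : nat), (1 <= j <= k)%N ->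
    P' [set w | X 0%N w = val i /\ Y 0%N w = j] =
    (lambda i j / \sum_(i' : I) \sum_(1 <= j' < k.+1) lambda i' j')%:E)
  (N : R.-ker T' ~> d.-tuple R)
  (hN : poisson_random_field P'
    (\sum_(i : I) \sum_(1 <= j < k.+1) lambda i j) N)
  (hNindep : independent2 P' (sigma_of_field N)
    (sigma_of_family [set: nat] (fun r w => (X r w, Y r w)))) :
  forall A : set (d.-tuple R), rectangle A ->
    eq_in_law
      P (fun w => \sum_(i : I) val i * (point_count (M i) A w)%:R)
      P' (fun w => \sum_(r < point_count N A w) X r w * (Y r w)%:R).
Proof.
move=> A rA.
set L := \sum_(i : I) \sum_(1 <= j < k.+1) lambda i j in hXYlaw hN.
pose K : finType := (I * 'I_k)%type.
pose rate (c : K) := lambda c.1 c.2.+1.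
have LE : L = \sum_c rate c.
  rewrite -(pair_bigA _ (fun i j => lambda i (nat_of_ord j).+1))/=.
  by apply: eq_bigr => i _; rewrite big_add1 big_mkord.
have L0 : 0 < L by have [] := hN.
have markE r w : exists c : K, X r w = val c.1 /\ Y r w = c.2.+1.
  have [Xr /andP[Yr Yk]] := hXY r w.
  have Yk' : ((Y r w).-1 < k)%N by rewrite prednK.
  by exists ([` Xr]%fset, Ordinal Yk'); rewrite /= prednK.
(* Each pair [(X r, Y r)] becomes a letter of the finite alphabet [K]; its second component is
   shifted, as ['I_k] starts at 0. *)
have [mark markP] : {mark : nat -> T' -> K | forall r w,
    X r w = val (mark r w).1 /\ Y r w = (mark r w).2.+1}.
  by exists (fun r w => sval (cid (markE r w))) => r w; case: cid.
have mark_fiber r c : mark r @^-1` [set c] =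
    [set w | X r w = val c.1 /\ Y r w = c.2.+1].
  apply/seteqP; split => w /=; first by move=> <-; exact: markP.
  have [-> ->] := markP r w; case: (mark r w) c => [i j] [i' j'] /=.
  by move=> [/val_inj -> [/val_inj ->]].
have sigma_mark r c :
    sigma_of (fun w => (X r w, Y r w)) (mark r @^-1` [set c]).
  exists ([set val c.1] `*` [set c.2.+1]).
    by apply: measurableX => //; exact: measurable_set1.
  by rewrite setTI mark_fiber.
have P_mark r c : P' (mark r @^-1` [set c]) = (rate c / L)%:E.
  have mc : measurable ([set val c.1] `*` [set c.2.+1] : set (R * nat)).
    by apply: measurableX => //; exact: measurable_set1.
  have [_ _ /(_ _ mc) XYr] := hXYident r.
  by rewrite mark_fiber [LHS]XYr; apply: hXYlaw; rewrite /= ltn_ord.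
pose prefix_eq s := [set w | [seq mark r w | r <- iota 0 (size s)] = s].
(* Only nonempty words are treated here: [c] serves as the default of [nth]. For the empty word
   [prefix_eq] is the whole space. *)
have prefixE c s : prefix_eq (c :: s) =
    \bigcap_(r in [set` iota 0 (size (c :: s))])
      mark r @^-1` [set nth c (c :: s) r].
  apply/seteqP; split => w.
    move=> sE r r_s.
    have {r_s} : r \in iota 0 (size (c :: s)) by [].
    rewrite mem_iota add0n => /andP[_ rs].
    rewrite -[_ w]/(mark r w = nth c (c :: s) r) -[X in nth c X]sE.
    by rewrite (nth_map 0%N) ?size_iota// nth_iota.
  move=> sE; apply: (@eq_from_nth _ c); rewrite ?size_map size_iota// => r rs.
  rewrite (nth_map 0%N) ?size_iota// nth_iota//.
  apply: sE; suff : r \in iota 0 (size (c :: s)) by [].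
  by rewrite mem_iota.
have F_prefix s :
    sigma_of_family [set: nat] (fun r w => (X r w, Y r w)) (prefix_eq s).
  case: s => [|c s].
    rewrite (_ : prefix_eq _ = setT); last exact/seteqP.
    exact: (@measurableT _ (g_sigma_algebraType _)).
  rewrite prefixE.
  apply: (@fin_bigcap_measurable _ (g_sigma_algebraType _)) => [|r _].
    exact: finite_seq.
  by apply: sub_gen_smallest; exists r.
have P_prefix s : P' (prefix_eq s) = (\prod_(c <- s) (rate c / L))%:E.
  case: s => [|c s].
    by rewrite big_nil (_ : prefix_eq _ = setT) ?probability_setT//; exact/seteqP.
  rewrite prefixE (mutually_independent_seq hXYindep) ?iota_uniq//.
  rewrite (eq_bigr _ (fun r _ => P_mark r _)) prodEFin.
  by rewrite [in RHS](big_nth c) /index_iota subn0.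
have m_prefix s : measurable (prefix_eq s).
  case: s => [|c s].
    by rewrite (_ : prefix_eq _ = setT)//; exact/seteqP.
  rewrite prefixE; apply: fin_bigcap_measurable => [|r _]; first exact: finite_seq.
  rewrite mark_fiber; apply: measurableI.
    exact: (measurable_funPTI (X r) (measurable_set1 _)).
  by apply: (@measurable_funPTI _ _ _ _ (Y r) [set _]).
pose total (n : {ffun I -> nat}) : R := \sum_(i : I) val i * (n i)%:R.
pose word_total (s : seq K) : R := \sum_(c <- s) val c.1 * c.2.+1%:R.
pose word w := [seq mark r w | r <- iota 0 (point_count N A w)].
have word_totalE w :
    \sum_(r < point_count N A w) X r w * (Y r w)%:R = word_total (word w).
  rewrite /word_total big_map -[in RHS](subn0 (point_count N A w)) big_mkord.
  by apply: eq_bigr => r _; have [-> ->] := markP r w.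
have lawS B := gprf_counts_law hM hMindep rA (total @^-1` B).
have lawW B := compound_words_law (word_total @^-1` B) m_prefix F_prefix P_prefix
  hNindep hN rA.
have SE : (fun w => \sum_(i : I) val i * (point_count (M i) A w)%:R) =
    total \o (fun w => [ffun i => point_count (M i) A w]).
  by apply/funext => w; apply: eq_bigr => i _; rewrite ffunE.
have WE : (fun w => \sum_(r < point_count N A w) X r w * (Y r w)%:R) =
    word_total \o word by apply/funext => w; exact: word_totalE.
rewrite SE WE; split => [_ B _|_ B _|B _].
- by rewrite setTI; have [] := lawS B.
- by rewrite setTI; have [] := lawW B.
have [_ PS] := lawS B; have [_ PW] := lawW B.
rewrite [LHS]PS [RHS]PW.
(* The mark counts of a word. [word_total] factors through them, so the words can be grouped by
   [cnt] and compared with the arrays [z] of [gprf_counts_law] one at a time. *)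
pose cnt (s : seq K) : {ffun I -> {ffun 'I_k -> nat}} :=
  [ffun i => [ffun j => count_mem (i, j) s]].
have cnt_total s : total [ffun i => \sum_(j < k) j.+1 * cnt s i j]%N = word_total s.
  rewrite /word_total sum_count_mem.
  rewrite -(pair_bigA _
    (fun i j => val i * (nat_of_ord j).+1%:R *+ count_mem (i, j) s))/=.
  apply: eq_bigr => i _; rewrite ffunE natr_sum mulr_sumr; apply: eq_bigr => j _.
  by rewrite !ffunE natrM mulrA mulr_natr.
rewrite (_ : word_total @^-1` B = cnt @^-1` [set z : {ffun I -> {ffun 'I_k -> nat}} |
    (total @^-1` B) [ffun i => \sum_(j < k) j.+1 * z i j]%N]); last first.
  by apply/seteqP; split => s; rewrite /= cnt_total.
have rate_ge0 c : 0 <= rate c by rewrite ltW// hlambda//= ltn_ord.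
rewrite [RHS]esum_fibers; last first.
  move=> s; rewrite lee_fin; apply: mulr_ge0.
    by rewrite pois_ge0// mulr_ge0 ?volume_ge0// ltW.
  by apply: prodr_ge0 => c _; apply: divr_ge0; [exact: rate_ge0|exact: ltW].
apply: eq_esum => z _.
transitivity (\prod_(c : K) pois (rate c * volume A) (z c.1 c.2))%:E.
  by rewrite -(pair_bigA _
    (fun i j => pois (lambda i (nat_of_ord j).+1 * volume A) (z i j))).
have L0' : 0 < \sum_c rate c by rewrite -LE.
(* The total mean, a sum of [rate c * volume A], is put back in the form [L * volume A] of the
   compound side. *)
rewrite -(esum_word_counts _ rate_ge0 L0' (volume_ge0 rA)) -mulr_suml -LE.
congr esum; apply/seteqP; split => [s sz|s <- [i j]]; last by rewrite !ffunE.
by apply/ffunP => i; apply/ffunP => j; rewrite !ffunE sz.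
Qed.
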